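(* For all $\delta\in(1,2)$ $$u_1(\delta)<\frac{(2-\delta)\,\delta}{\delta-1}+(2-\delta)+\tfrac12(2-\delta)^2+\tfrac13(2-\delta)^3.$$
   Context: For $\delta\in(1,2)$, $u_1(\delta)$ denotes the unique positive solution $u$ of $$e^{-u}=1-\frac{\delta u}{u+\delta}.$$ *)

(* Defs.v *)
From Stdlib Require Import Reals Lra ClassicalEpsilon.
Open Scope R_scope.

Definition u1_eq (delta u : R) : Prop :=
  0 < u /\ exp (- u) = 1 - delta * u / (u + delta).

(* The value is junk unless the equation is solvable; [u1_spec] below shows that
   for 1 < delta < 2 this is the unique positive solution. *)
Definition u1 (delta : R) : R := epsilon (inhabits 0) (u1_eq delta).

Section WellDefined.
Variable delta : R.
Hypothesis Hd : 1 < delta < 2.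

(* For u > 0 the equation is g u = 0, after clearing the denominator. *)
Let g u := delta * u - (u + delta) * (1 - exp (- u)).
Let g' u := delta - 1 + (1 - delta - u) * exp (- u).
Let g'' u := (u + delta - 2) * exp (- u).

Local Lemma expN_derive (u : R) :
  derivable_pt_lim (fun x => exp (- x)) u (- exp (- u)).
Proof.
replace (- exp (- u)) with (exp (- u) * (- 1)) by ring.
apply (derivable_pt_lim_comp Ropp exp).
- apply (derivable_pt_lim_opp id), derivable_pt_lim_id.
- apply derivable_pt_lim_exp.
Qed.

Local Lemma derive_ext (f h : R -> R) (u l m : R) :
  (forall x, f x = h x) -> l = m ->
  derivable_pt_lim f u l -> derivable_pt_lim h u m.
Proof.
intros E <- H eps Heps; destruct (H eps Heps) as [al Hal]; exists al.
intros k k0 kal; rewrite <- !E; exact (Hal k k0 kal).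
Qed.

Local Lemma affine_derive (a b u : R) :
  derivable_pt_lim (fun x => a * x + b) u a.
Proof.
apply (derive_ext (fun x => a * x + b) _ u (a * 1 + 0)); [easy | ring |].
apply (derivable_pt_lim_plus (fun x => a * x) (fun _ => b)).
- apply (derivable_pt_lim_scal id), derivable_pt_lim_id.
- apply derivable_pt_lim_const.
Qed.

Local Lemma affine_exp_derive (a b c d u : R) :
  derivable_pt_lim (fun x => (a * x + b) + (c * x + d) * exp (- x)) u
    (a + (c * exp (- u) + (c * u + d) * (- exp (- u)))).
Proof.
apply (derivable_pt_lim_plus (fun x => a * x + b)
         (fun x => (c * x + d) * exp (- x))).
- apply affine_derive.
- apply (derivable_pt_lim_mult (fun x => c * x + d) (fun x => exp (- x))).
  + apply affine_derive.
  + apply expN_derive.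
Qed.

Local Lemma g_derive (u : R) : derivable_pt_lim g u (g' u).
Proof.
eapply derive_ext; [| | apply (affine_exp_derive (delta - 1) (- delta) 1 delta)].
- intros x; unfold g; ring.
- unfold g'; ring.
Qed.

Local Lemma g'_derive (u : R) : derivable_pt_lim g' u (g'' u).
Proof.
eapply derive_ext;
  [| | apply (affine_exp_derive 0 (delta - 1) (- 1) (1 - delta))].
- intros x; unfold g'; ring.
- unfold g''; ring.
Qed.

Local Lemma g_0 : g 0 = 0.
Proof. unfold g; rewrite Ropp_0, exp_0; ring. Qed.

Local Lemma g'_0 : g' 0 = 0.
Proof. unfold g'; rewrite Ropp_0, exp_0; ring. Qed.

Local Lemma u1_eqE (u : R) : 0 < u -> u1_eq delta u <-> g u = 0.
Proof.
intros Hu; unfold u1_eq, g.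
assert (E : delta * u / (u + delta) * (u + delta) = delta * u) by (field; lra).
split.
- intros [_ H]; rewrite H.
  transitivity (delta * u - delta * u / (u + delta) * (u + delta)); [ring | lra].
- intros H; split; [exact Hu |].
  apply (Rmult_eq_reg_r (u + delta)); lra.
Qed.

Local Lemma rolle (f f' : R -> R) (a b : R) :
  (forall x, derivable_pt_lim f x (f' x)) -> a < b -> f a = f b ->
  exists c, a < c < b /\ f' c = 0.
Proof.
intros D ab E.
destruct (MVT_cor2 f f' a b ab (fun c _ => D c)) as [c [H Hc]].
exists c; split; [exact Hc |].
apply (Rmult_eq_reg_r (b - a)); lra.
Qed.

Local Lemma g''_root (u : R) : g'' u = 0 -> u = 2 - delta.
Proof.
unfold g''; intros H.
destruct (Rmult_integral _ _ H) as [H0 | H0]; [lra |].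
pose proof (exp_pos (- u)); lra.
Qed.

Local Lemma g_root_no_lt (a b : R) : 0 < a -> a < b -> g a = 0 -> g b = 0 -> False.
Proof.
intros Ha ab Ga Gb.
destruct (rolle g g' 0 a g_derive Ha) as [c1 [Hc1 Dc1]]; [rewrite g_0; lra |].
destruct (rolle g g' a b g_derive ab) as [c2 [Hc2 Dc2]]; [lra |].
destruct (rolle g' g'' 0 c1 g'_derive) as [d1 [Hd1 E1]]; [lra | rewrite g'_0; lra |].
destruct (rolle g' g'' c1 c2 g'_derive) as [d2 [Hd2 E2]]; [lra | lra |].
apply g''_root in E1; apply g''_root in E2; lra.
Qed.

Local Lemma g_neg : g (2 - delta) < 0.
Proof.
assert (He : 0 < 2 - delta) by lra.
destruct (MVT_cor2 g g' 0 (2 - delta) He (fun c _ => g_derive c)) as [c [H Hc]].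
destruct (MVT_cor2 g' g'' 0 c (proj1 Hc) (fun c _ => g'_derive c)) as [d [H' Hd']].
rewrite g_0 in H; rewrite g'_0 in H'.
assert (g'' d < 0) by (unfold g''; pose proof (exp_pos (- d)); nra).
assert (g' c < 0) by nra.
nra.
Qed.

Local Lemma g_pos : 0 < g (2 * delta / (delta - 1)).
Proof.
set (u := 2 * delta / (delta - 1)).
assert (E : u * (delta - 1) = 2 * delta) by (unfold u; field; lra).
assert (0 < u) by (unfold u; apply Rdiv_lt_0_compat; lra).
unfold g; pose proof (exp_pos (- u)); nra.
Qed.

Lemma u1_exists : exists u, u1_eq delta u.
Proof.
assert (ab : 2 - delta < 2 * delta / (delta - 1)).
{ apply (Rmult_lt_reg_r (delta - 1)); [lra |].
  replace (2 * delta / (delta - 1) * (delta - 1)) with (2 * delta) by (field; lra).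
  nra. }
assert (C : continuity g).
{ intros x; apply derivable_continuous_pt; exists (g' x); apply g_derive. }
destruct (IVT g _ _ C ab g_neg g_pos) as [u [Hu Gu]].
exists u; apply u1_eqE; [lra | exact Gu].
Qed.

Lemma u1_spec : unique (u1_eq delta) (u1 delta).
Proof.
assert (S : u1_eq delta (u1 delta)).
{ apply (epsilon_spec (inhabits 0) (u1_eq delta)), u1_exists. }
split; [exact S |].
intros v Hv.
assert (Su := proj1 S); assert (Sv := proj1 Hv).
apply (u1_eqE _ Su) in S; apply (u1_eqE _ Sv) in Hv.
destruct (Rtotal_order (u1 delta) v) as [L | [L | L]]; [| exact L |]; exfalso.
- exact (g_root_no_lt _ _ Su L S Hv).
- exact (g_root_no_lt _ _ Sv L Hv S).
Qed.

End WellDefined.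

(* Main.v *)
Require Import Defs.
From Stdlib Require Import Reals Lra.
From Coquelicot Require Import Coquelicot.
Open Scope R_scope.

(** Write [e = 2 - delta], so that [0 < e < 1], and let [U] be the claimed upper
    bound.  Clearing the denominator in the equation gives [gap delta u = 0]; the
    gap is negative at [u = e], so as soon as it is positive at [U > e] the
    intermediate value theorem places the unique positive root [u1 delta] below
    [U] ([u1_lt_of_gap_pos]).

    Everything is rational in [e] apart from [exp (- U)]:
    [U + delta = A e / (1 - e)] and [delta - (delta - 1) * U = (1 - e) * B e]
    for the polynomials [A] and [B] below, so that
    [gap delta U = A e / (1 - e) * exp (- U) - (1 - e) * B e].
    If [B e <= 0] this is clearly positive.  Otherwise, taking logarithms,
    positivity says that
    [logratio e = ln (A e) - ln (B e) - 2 * ln (1 - e) - U] is positive.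
    This function vanishes at [0], and its derivative is a rational function
    whose numerator is [e ^ 4] times a polynomial that is positive on [(0, 1)]
    ([logratio_derive], [logratio_pos]).  The factor [e ^ 4] is no
    accident: [u1 delta] and [U] share the expansion [3 * e + 3 / 2 * e ^ 2] up
    to a term of order [e ^ 3], and near there the slope of the gap is of order
    [e ^ 2], so that the gap at [U], and with it [logratio e], is of order
    [e ^ 5]. *)

Definition gap (delta u : R) : R := delta * u - (u + delta) * (1 - exp (- u)).

(** The gap also vanishes at [0], so the intermediate value theorem is applied
    from [2 - delta], its inflection point, where it is already negative. *)
Lemma u1_lt_of_gap_pos (delta U : R) :
  1 < delta < 2 -> 2 - delta < U -> 0 < gap delta U -> u1 delta < U.
Proof.
intros Hd HU GU.
assert (C : continuity (gap delta)).
{ intros x; apply derivable_continuous_pt; eexists; apply (Defs.g_derive delta). }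
destruct (IVT (gap delta) _ _ C HU (Defs.g_neg delta Hd) GU) as [v [Hv Gv]].
assert (Sv : u1_eq delta v) by (apply Defs.u1_eqE; [exact Hd | lra | exact Gv]).
rewrite (proj2 (u1_spec delta Hd) v Sv).
(* [v = U] is excluded because the gap is positive at [U] *)
destruct (proj2 Hv) as [L | ->]; lra.
Qed.

Definition bound (e : R) : R :=
  e * (2 - e) / (1 - e) + e + / 2 * e ^ 2 + / 3 * e ^ 3.

Definition A (e : R) : R := 2 - e ^ 2 / 2 - e ^ 3 / 6 - e ^ 4 / 3.

Definition B (e : R) : R := 2 - 2 * e - e ^ 2 / 2 - e ^ 3 / 3.

Definition logratio (e : R) : R :=
  ln (A e) - ln (B e) - 2 * ln (1 - e) - bound e.

Definition logratio_num (e : R) : R :=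
  36 - 81 * e + 149 / 2 * e ^ 2 - 14 * e ^ 3 + 18 * e ^ 4
  - 29 / 2 * e ^ 5 - 2 * e ^ 6 - 2 * e ^ 7.

Lemma A_pos (e : R) : 0 <= e < 1 -> 0 < A e.
Proof.
intros He; unfold A.
assert (P : forall n, e ^ n <= 1).
{ intros n; rewrite <- (pow1 n); apply pow_incr; lra. }
pose proof (P 2%nat); pose proof (P 3%nat); pose proof (P 4%nat); lra.
Qed.

Lemma B_antitone (x y : R) : 0 <= x <= y -> B y <= B x.
Proof.
intros [x0 xy]; unfold B.
pose proof (pow_incr x y 2 (conj x0 xy)).
pose proof (pow_incr x y 3 (conj x0 xy)).
lra.
Qed.

Lemma logratio_derive (e : R) :
  0 <= e < 1 -> 0 < B e ->
  derivable_pt_lim logratio e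
    (e ^ 4 * logratio_num e / (18 * A e * B e * (1 - e) ^ 2)).
Proof.
intros He HB; pose proof (A_pos e He) as HA.
apply is_derive_Reals.
unfold logratio, bound, logratio_num, A, B in *.
auto_derive.
- repeat split; lra.
- field; repeat split; lra.
Qed.

(** Since [e < 1], the powers of [e] above the fourth may be lowered to [e ^ 4],
    and [e ^ 3], [e ^ 4] to [e ^ 2]; what is left is at least
    [36 - 81 * e + 60 * e ^ 2], of negative discriminant. *)
Lemma logratio_num_pos (e : R) : 0 <= e < 1 -> 0 < logratio_num e.
Proof.
intros He; unfold logratio_num.
assert (D : forall n, 0 <= e ^ S n <= e ^ n).
{ intros n; pose proof (pow_le e n (proj1 He)); simpl; nra. }
pose proof (D 2%nat); pose proof (D 3%nat); pose proof (D 4%nat).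
pose proof (D 5%nat); pose proof (D 6%nat).
assert (0 < 36 - 81 * e + 60 * e ^ 2) by nra.
lra.
Qed.

Lemma logratio_0 : logratio 0 = 0.
Proof.
unfold logratio, bound, A, B.
replace (2 - 0 ^ 2 / 2 - 0 ^ 3 / 6 - 0 ^ 4 / 3) with 2 by field.
replace (2 - 2 * 0 - 0 ^ 2 / 2 - 0 ^ 3 / 3) with 2 by field.
rewrite Rminus_0_r, ln_1; field.
Qed.

Lemma logratio_pos (e : R) : 0 < e < 1 -> 0 < B e -> 0 < logratio e.
Proof.
intros He HB.
assert (HBx : forall x, 0 <= x <= e -> 0 < B x).
{ intros x Hx; apply (Rlt_le_trans _ _ _ HB), B_antitone, Hx. }
edestruct (MVT_cor2 logratio) as [c [H Hc]]; [exact (proj1 He) | |].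
{ intros x Hx; apply logratio_derive; [lra | exact (HBx x Hx)]. }
rewrite logratio_0, !Rminus_0_r in H; rewrite H.
assert (Hc1 : 0 <= c < 1) by lra.
pose proof (A_pos c Hc1); pose proof (logratio_num_pos c Hc1).
assert (0 < B c) by (apply HBx; lra).
assert (0 < c ^ 4) by (apply pow_lt; lra).
assert (0 < (1 - c) ^ 2) by (apply pow_lt; lra).
apply Rmult_lt_0_compat; [| lra].
apply Rdiv_lt_0_compat; repeat apply Rmult_lt_0_compat; lra.
Qed.

Lemma gap_bound (e : R) :
  e < 1 ->
  gap (2 - e) (bound e) = A e / (1 - e) * exp (- bound e) - (1 - e) * B e.
Proof.
intros He; unfold gap.
replace (A e / (1 - e)) with (bound e + (2 - e)) by (unfold A, bound; field; lra).
replace ((1 - e) * B e) with ((2 - e) - (1 - e) * bound e)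
  by (unfold B, bound; field; lra).
ring.
Qed.

Lemma gap_bound_pos (e : R) : 0 < e < 1 -> 0 < gap (2 - e) (bound e).
Proof.
intros He; rewrite gap_bound by lra.
assert (HA : 0 < A e) by (apply A_pos; lra).
assert (HE := exp_pos (- bound e)).
destruct (Rle_lt_dec (B e) 0) as [HB | HB].
- assert (0 < A e / (1 - e) * exp (- bound e)).
  { apply Rmult_lt_0_compat; [apply Rdiv_lt_0_compat |]; lra. }
  nra.
- pose proof (logratio_pos e He HB) as L; unfold logratio in L.
  assert (H : (1 - e) * (1 - e) * B e < A e * exp (- bound e)).
  { apply ln_lt_inv; [repeat apply Rmult_lt_0_compat; lra
                     | apply Rmult_lt_0_compat; lra |].
    rewrite !ln_mult, ln_exp by (try apply Rmult_lt_0_compat; lra).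
    lra. }
  apply (Rmult_lt_reg_l (1 - e)); [lra |].
  replace ((1 - e) * (A e / (1 - e) * exp (- bound e) - (1 - e) * B e))
    with (A e * exp (- bound e) - (1 - e) * (1 - e) * B e) by (field; lra).
  lra.
Qed.

Lemma bound_gt (e : R) : 0 < e < 1 -> e < bound e.
Proof.
intros He; unfold bound.
assert (0 < e * (2 - e) / (1 - e)).
{ apply Rdiv_lt_0_compat; [apply Rmult_lt_0_compat |]; lra. }
assert (0 < e ^ 2) by (apply pow_lt; lra).
assert (0 < e ^ 3) by (apply pow_lt; lra).
lra.
Qed.

Theorem proposition19 (delta : R) (hdelta : 1 < delta < 2) :
  u1 delta <
    (2 - delta) * delta / (delta - 1) + (2 - delta)
    + / 2 * (2 - delta) ^ 2 + / 3 * (2 - delta) ^ 3.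
Proof.
assert (He : 0 < 2 - delta < 1) by lra.
pose proof (gap_bound_pos _ He) as G.
pose proof (bound_gt _ He) as L.
replace (2 - (2 - delta)) with delta in G by ring.
pose proof (u1_lt_of_gap_pos delta _ hdelta L G) as H.
unfold bound in H.
replace (2 - (2 - delta)) with delta in H by ring.
replace (1 - (2 - delta)) with (delta - 1) in H by ring.
exact H.
Qed.
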